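(* Assume CH. Then for every sequence $\bar p=\langle p_\delta:\delta<\omega_1\rangle$ of partitions $p_\delta:[\omega_1]^2\to\omega$ the following all hold: $\aleph_1\nrightarrow_{\bar p}[\aleph_1]^2_{\aleph_1}$; $\aleph_1\nrightarrow_{\bar p}[\aleph_1\circledast\aleph_1]^2_{\aleph_1}$; $\aleph_1\nrightarrow_{\bar p}[\aleph_0\circledast\aleph_1/1\circledast\aleph_1]^2_{\aleph_1}$; $\Pr_1(\aleph_1,\aleph_1,\aleph_1,\aleph_0)_{\bar p}$; $\Pr_0(\aleph_1,\aleph_1,\aleph_1,\aleph_0)_{\bar p}$.
   Context: For $f:[\kappa]^2\to\lambda$ and $p:[\kappa]^2\to\theta$, $X\subseteq[\kappa]^2$ is $(f,p)$-strong if for every $\zeta:\theta\to\lambda$ there is $\{\alpha,\beta\}\in X$ with $f(\alpha,\beta)=\zeta(p(\alpha,\beta))$. $A\circledast B=\{\{\alpha,\beta\}:\alpha<\beta,\ \alpha\in A,\ \beta\in B\}$. For a partition $p$: $\kappa\nrightarrow_p[\mu]^2_\lambda$ means there is $f:[\kappa]^2\to\lambda$ with $[A]^2$ $(f,p)$-strong for all $A\in[\kappa]^\mu$; $\kappa\nrightarrow_p[\mu_1\circledast\mu_2]^2_\lambda$ means there is $f$ with $A\circledast B$ $(f,p)$-strong for all $A\in[\kappa]^{\mu_1},B\in[\kappa]^{\mu_2}$; $\aleph_1\nrightarrow_p[\aleph_0\circledast\aleph_1/1\circledast\aleph_1]^2_\lambda$ means there is $f:[\omega_1]^2\to\lambda$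 such that for every countably infinite $A\subseteq\omega_1$ and uncountable $B\subseteq\omega_1$ there is $\alpha\in A$ with $\{\alpha\}\circledast B$ $(f,p)$-strong. $\Pr_1(\kappa,\mu,\lambda,\chi)_p$: there is $f$ such that for every $\xi<\chi$, every family $\mathcal A\subseteq[\kappa]^{<\xi}$ of $\mu$ pairwise disjoint nonempty sets and every $\zeta\in\lambda^\theta$ there are $a,b\in\mathcal A$, $\max a<\min b$, with $f(\alpha,\beta)=\zeta(p(\alpha,\beta))$ for all $\alpha\in a,\beta\in b$. $\Pr_0(\kappa,\mu,\lambda,\chi)_p$: there is $f$ such that for every $\xi<\chi$, every pairwise disjoint $\mathcal A\subseteq[\kappa]^\xi$ with $|\mathcal A|=\mu$ and every matrix $\langle\zeta_{i,j}:i,j<\xi\rangle$ of elements of $\lambda^\theta$ there are $a,b\in\mathcal A$ with $\max a<\min b$ and $f(a(i),b(j))=\zeta_{i,j}(p(a(i),b(j)))$ for all $i,j<\xi$ ($a(i)$ the $i$-th element of $a$ in increasing order). With a sequence $\bar p=\langle p_\delta\rangle$: a single $f$ witnesses the symbol for every $p_\delta$. *)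

(* Defs.v *)
From Stdlib Require Import List.
Import ListNotations.

Section Defs.
Variable W : Type.
Variable lt : W -> W -> Prop.

Definition countable (A : W -> Prop) : Prop :=
  exists g : W -> nat, forall x y, A x -> A y -> g x = g y -> x = y.
Definition uncountable (A : W -> Prop) : Prop := ~ countable A.
Definition finite (A : W -> Prop) : Prop :=
  exists l : list W, forall x, A x -> In x l.
Definition countably_infinite (A : W -> Prop) : Prop :=
  countable A /\ ~ finite A.

Definition is_omega1 : Prop :=
  (forall x, ~ lt x x) /\
  (forall x y z, lt x y -> lt y z -> lt x z) /\
  (forall x y, lt x y \/ x = y \/ lt y x) /\
  well_founded lt /\
  (forall a, countable (fun x => lt x a)) /\
  uncountable (fun _ => True).

Definition CH_holds : Prop :=
  exists e : W -> (nat -> bool),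
    (forall x y, e x = e y -> x = y) /\ (forall r, exists x, e x = r).

(* A pair {a,b} of [W]^2 is represented by (a,b) with lt a b.
   Colourings f : [W]^2 -> W (lambda = aleph_1),
   partitions p : [W]^2 -> nat (theta = omega).
   X (a set of pairs, given as a relation on a < b) is (f,p)-strong. *)
Definition strong (f : W -> W -> W) (p : W -> W -> nat)
    (X : W -> W -> Prop) : Prop :=
  forall zeta : nat -> W,
    exists a b, lt a b /\ X a b /\ f a b = zeta (p a b).

Definition sq (A : W -> Prop) : W -> W -> Prop := fun a b => A a /\ A b.
Definition circ (A B : W -> Prop) : W -> W -> Prop := fun a b => A a /\ B b.

Definition neg_sq (pbar : W -> W -> W -> nat) : Prop :=
  exists f : W -> W -> W, forall d (A : W -> Prop),
    uncountable A -> strong f (pbar d) (sq A).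

Definition neg_circ (pbar : W -> W -> W -> nat) : Prop :=
  exists f : W -> W -> W, forall d (A B : W -> Prop),
    uncountable A -> uncountable B -> strong f (pbar d) (circ A B).

Definition neg_circ01 (pbar : W -> W -> W -> nat) : Prop :=
  exists f : W -> W -> W, forall d (A B : W -> Prop),
    countably_infinite A -> uncountable B ->
    exists a, A a /\ strong f (pbar d) (circ (fun x => x = a) B).

(* Pr_1(aleph_1, aleph_1, aleph_1, aleph_0)_{pbar}.
   A family of aleph_1 pairwise disjoint nonempty sets of size < xi is
   given as an indexing by W (which has size aleph_1): the i-th member is
   { s i k | k < len i }, with 0 < len i < xi; disjointness of distinct
   members is required. *)
Definition Pr1 (pbar : W -> W -> W -> nat) : Prop :=
  exists f : W -> W -> W, forall d (xi : nat)
    (len : W -> nat) (s : W -> nat -> W),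
    (forall i, 0 < len i < xi) ->
    (forall i j k l, k < len i -> l < len j -> s i k = s j l -> i = j) ->
    forall zeta : nat -> W,
      exists i j, i <> j /\
        (forall k l, k < len i -> l < len j -> lt (s i k) (s j l)) /\
        (forall k l, k < len i -> l < len j ->
           f (s i k) (s j l) = zeta (pbar d (s i k) (s j l))).

(* Pr_0(aleph_1, aleph_1, aleph_1, aleph_0)_{pbar}.
   A family of aleph_1 pairwise disjoint sets of size xi is indexed by W;
   the i-th member is { s i k | k < xi }, listed increasingly
   (s i k is its k-th element). *)
Definition Pr0 (pbar : W -> W -> W -> nat) : Prop :=
  exists f : W -> W -> W, forall d (xi : nat) (s : W -> nat -> W),
    (forall i k l, k < l < xi -> lt (s i k) (s i l)) ->
    (forall i j k l, k < xi -> l < xi -> s i k = s j l -> i = j) ->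
    forall zeta : nat -> nat -> (nat -> W),
      exists i j, i <> j /\
        (forall k l, k < xi -> l < xi -> lt (s i k) (s j l)) /\
        (forall k l, k < xi -> l < xi ->
           f (s i k) (s j l) = zeta k l (pbar d (s i k) (s j l))).
End Defs.

(* Main.v *)
Require Import Defs.
From Stdlib Require Import List.
From Stdlib Require Import Arith Lia Cantor Sorted.
From Stdlib Require Import Classical ClassicalEpsilon.
From Stdlib Require Import FunctionalExtensionality.
Import ListNotations.

(** One colouring [f] witnesses all five relations. By CH, the countable
    "tasks" (a sequence of pairwise disjoint [n]-element sets [a m] together
    with target functions [z m i l : nat -> W]) are coded by elements of [W].
    The column [f (., b)] is built by recursion on [b] as a generic object: for
    each of the countably many tasks coded below [b], each [d] below [b] and
    each finite list of earlier columns, if infinitely many [m] meet the targets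
    of the task on these earlier columns, then infinitely many of those [m] also
    meet the next target on the column [b]. Listing a finite set
    [b_0 < ... < b_(n-1)] lying above a task, induction along the [b_k] yields
    infinitely many [m] for which all [n * n] targets are met simultaneously.
    For [n = 1], a task with a different target function for each [m]
    diagonalises against failure at every point of a countable set. *)

(** * Choice, and injective codes for pairs and finite lists of numbers *)

Lemma choice (A B : Type) (R : A -> B -> Prop) :
  (forall x, exists y, R x y) -> exists f : A -> B, forall x, R x (f x).
Proof.
  intro H.
  exists (fun x => proj1_sig (constructive_indefinite_description _ (H x))).
  intro x. apply proj2_sig.
Qed.
Arguments choice {A B}.

Lemma to_nat_inj (x y : nat * nat) : to_nat x = to_nat y -> x = y.
Proof.
  intro H. rewrite <- (cancel_of_to x), <- (cancel_of_to y), H. reflexivity.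
Qed.

Fixpoint list_code (l : list nat) : nat :=
  match l with
  | [] => 0
  | x :: l' => S (to_nat (x, list_code l'))
  end.

Lemma list_code_inj (l l' : list nat) : list_code l = list_code l' -> l = l'.
Proof.
  revert l'; induction l as [|x l IH]; intros [|y l'] H;
    cbn [list_code] in H; try discriminate; auto.
  apply eq_add_S, to_nat_inj in H. injection H as -> H.
  now rewrite (IH _ H).
Qed.

Definition infinitely_many (X : nat -> Prop) : Prop :=
  forall N, exists m, N <= m /\ X m.

(** * Countable, uncountable and infinite sets *)

Section Countability.
Variable W : Type.

Lemma countable_subset (A B : W -> Prop) :
  (forall x, A x -> B x) -> countable W B -> countable W A.
Proof. intros H [g Hg]. exists g. auto. Qed.

Lemma countable_of_enum (A : W -> Prop) (u : nat -> W) :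
  (forall x, A x -> exists n, u n = x) -> countable W A.
Proof.
  intros H.
  destruct (choice (fun x n => A x -> u n = x)) as [g Hg].
  { intro x. destruct (classic (A x)) as [Hx|Hx].
    - destruct (H x Hx) as [n Hn]. now exists n.
    - now exists 0. }
  exists g. intros x y Hx Hy E.
  now rewrite <- (Hg x Hx), <- (Hg y Hy), E.
Qed.

Lemma enum_of_countable (A : W -> Prop) (z : W) :
  countable W A -> exists u : nat -> W, forall x, A x -> exists n, u n = x.
Proof.
  intros [g Hg].
  destruct (choice (fun n x => forall y, A y -> g y = n -> y = x)) as [u Hu].
  { intro n. destruct (classic (exists y, A y /\ g y = n)) as [[y [Hy E]]|H].
    - exists y. intros y' Hy' E'. apply Hg; congruence.
    - exists z. intros y Hy E. exfalso; eauto. }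
  exists u. intros x Hx. exists (g x). symmetry. now apply Hu.
Qed.

(** This lets one column treat every request made with parameters from a countable initial segment.
    An injection on [A] turns the lists over [A] into lists of numbers, which have injective
    codes. *)
Lemma enum_tasks (A : W -> Prop) :
  countable W A ->
  exists u : nat -> nat * list W,
    forall n l, Forall A l -> exists t, u t = (n, l).
Proof.
  intros [g Hg].
  set (code := fun (n : nat) (l : list W) => to_nat (n, list_code (map g l))).
  assert (Hinj : forall n l n' l', Forall A l -> Forall A l' ->
            code n l = code n' l' -> (n, l) = (n', l')).
  { intros n l n' l' Hl Hl' E. apply to_nat_inj in E. injection E as -> E.
    apply list_code_inj in E. f_equal. revert l' Hl' E.
    induction Hl as [|x l Hx Hl IH]; intros [|y l'] Hl' E; cbn in E;
      try discriminate; auto.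
    injection E as E1 E2. inversion Hl'; subst. f_equal; auto. }
  destruct (choice (fun t p => forall n l, Forall A l -> code n l = t ->
                                 p = (n, l))) as [u Hu].
  { intro t.
    destruct (classic (exists n l, Forall A l /\ code n l = t))
      as [[n [l [Hl E]]]|H].
    - exists (n, l). intros n' l' Hl' E'. apply Hinj; congruence.
    - exists (0, []). intros n l Hl E. exfalso; eauto. }
  exists u. intros n l Hl. exists (code n l). now apply Hu.
Qed.

(** If each fibre had an injection [g n] into the numbers, pairing [c x] with [g (c x) x] would
    inject all of [A]. *)
Lemma uncountable_fibre (A : W -> Prop) (c : W -> nat) :
  uncountable W A -> exists n, uncountable W (fun x => A x /\ c x = n).
Proof.
  intro HA. apply NNPP. intro H. apply HA.
  destruct (choice (fun n (g : W -> nat) => forall x y, A x /\ c x = n ->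
              A y /\ c y = n -> g x = g y -> x = y)) as [g Hg].
  { intro n. apply NNPP. intro Hn. apply H. now exists n. }
  exists (fun x => to_nat (c x, g (c x) x)). intros x y Hx Hy E.
  apply to_nat_inj in E. injection E as E1 E2. rewrite <- E1 in E2.
  apply (Hg (c x)); auto.
Qed.

Lemma uncountable_inhabited (A : W -> Prop) :
  uncountable W A -> exists x, A x.
Proof.
  intro HA. apply NNPP. intro H. apply HA. exists (fun _ => 0).
  intros x y Hx. exfalso; eauto.
Qed.

Lemma uncountable_not_finite (A : W -> Prop) :
  uncountable W A -> ~ finite W A.
Proof.
  intros HA [l Hl]. destruct (uncountable_inhabited A HA) as [z _]. apply HA.
  apply (countable_of_enum A (fun n => nth n l z)). intros x Hx.
  destruct (In_nth l x z (Hl x Hx)) as [n [_ E]]. now exists n.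
Qed.

Lemma infinite_sequence (A : W -> Prop) :
  ~ finite W A ->
  exists u : nat -> W, (forall n, A (u n)) /\ (forall m n, u m = u n -> m = n).
Proof.
  intro HA.
  destruct (choice (fun (l : list W) x => A x /\ ~ In x l)) as [pick Hp].
  { intro l. apply NNPP. intro H. apply HA. exists l. intros x Hx.
    apply NNPP. intro Hn. apply H. now exists x. }
  set (L := fix L n := match n with 0 => [] | S n => pick (L n) :: L n end).
  exists (fun n => pick (L n)). split; [intro n; apply Hp|].
  assert (Hlt : forall n m, m < n -> In (pick (L m)) (L n)).
  { induction n as [|n IH]; intros m Hm; [lia|]. cbn.
    destruct (Nat.eq_dec m n) as [->|]; [now left|right; apply IH; lia]. }
  intros m n E. destruct (Nat.lt_trichotomy m n) as [H|[H|H]]; auto; exfalso.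
  - apply (proj2 (Hp (L n))). rewrite <- E. now apply Hlt.
  - apply (proj2 (Hp (L m))). rewrite E. now apply Hlt.
Qed.

End Countability.

(** * Building one generic column, and recursion along a well-founded order *)

Section Columns.
Variable W : Type.

Definition disjoint_sets (n : nat) (a : nat -> nat -> W) : Prop :=
  forall m m' i i', i < n -> i' < n -> a m i = a m' i' -> m = m' /\ i = i'.

(** By disjointness each point of [L] lies in at most one of the sets, so it excludes at most one
    index [m]. *)
Lemma disjoint_sets_avoid (n : nat) (a : nat -> nat -> W) (L : list W) :
  disjoint_sets n a ->
  exists M, forall m i, M <= m -> i < n -> ~ In (a m i) L.
Proof.
  intro Ha. induction L as [|x L [M HM]].
  - exists 0. auto.
  - destruct (classic (exists m i, i < n /\ a m i = x)) as [[m [i [Hi E]]]|H].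
    + exists (M + S m). intros m' i' Hm' Hi' [E'|Hin].
      * destruct (Ha m m' i i') as [-> _]; try congruence; lia.
      * apply (HM m' i'); auto; lia.
    + exists M. intros m i Hm Hi [E|Hin].
      * apply H. exists m, i. auto.
      * now apply (HM m i).
Qed.

(** Each stage picks a set of its request that is disjoint from everything picked before, so the
    values prescribed at different stages never conflict. [V] marks the requests that must be
    served. *)
Lemma generic_column (V : nat -> Prop) (n : nat -> nat)
    (X : nat -> nat -> Prop) (a v : nat -> nat -> nat -> W) (z : W) :
  (forall t, V t -> disjoint_sets (n t) (a t)) ->
  (forall t, V t -> infinitely_many (X t)) ->
  exists h : W -> W, forall t, V t ->
    infinitely_many (fun m => X t m /\
                       forall i, i < n t -> h (a t m i) = v t m i).
Proof.
  intros Ha HX.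
  (* Stage [q = to_nat (t, N)] serves the demand [N <= m] of request [t]. *)
  set (T := fun q => fst (of_nat q)).
  destruct (choice (fun (qL : nat * list W) m => V (T (fst qL)) ->
     snd (of_nat (fst qL)) <= m /\ X (T (fst qL)) m /\
     forall i, i < n (T (fst qL)) -> ~ In (a (T (fst qL)) m i) (snd qL)))
    as [pick Hp].
  { intros [q L]; cbn [fst snd]. destruct (classic (V (T q))) as [HV|HV].
    - destruct (disjoint_sets_avoid (n (T q)) (a (T q)) L) as [M HM]; auto.
      destruct (HX _ HV (snd (of_nat q) + M)) as [m [Hm HXm]].
      exists m. intros _. repeat split; auto; try lia.
      intros i Hi. apply HM; auto; lia.
    - now exists 0. }
  (* [L q] lists all points of the sets picked before stage [q]; [M q] is the index picked at stage
     [q]. *)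
  set (L := fix L q := match q with
    | 0 => []
    | S q => map (a (T q) (pick (q, L q))) (seq 0 (n (T q))) ++ L q end).
  set (M := fun q => pick (q, L q)).
  assert (Hlt : forall q q' i, q' < q -> i < n (T q') ->
             In (a (T q') (M q') i) (L q)).
  { induction q as [|q IH]; intros q' i Hq Hi; [lia|]. cbn [L].
    apply in_or_app. destruct (Nat.eq_dec q' q) as [->|].
    - left. apply in_map, in_seq. lia.
    - right. apply IH; auto; lia. }
  assert (Hdis : forall q q' i i', V (T q) -> V (T q') -> i < n (T q) ->
      i' < n (T q') -> a (T q) (M q) i = a (T q') (M q') i' ->
      q = q' /\ i = i').
  { intros q q' i i' HV HV' Hi Hi' E.
    destruct (Nat.lt_trichotomy q q') as [H|[H|H]].
    - exfalso. destruct (Hp (q', L q') HV') as [_ [_ Hn]].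
      apply (Hn i' Hi'). cbn [fst snd]. change (pick (q', L q')) with (M q').
      rewrite <- E. now apply Hlt.
    - subst q'. split; auto. eapply (Ha (T q) HV); eauto.
    - exfalso. destruct (Hp (q, L q) HV) as [_ [_ Hn]].
      apply (Hn i Hi). cbn [fst snd]. change (pick (q, L q)) with (M q).
      rewrite E. now apply Hlt. }
  (* A point is prescribed by at most one stage and position, by [Hdis]; points never prescribed
     receive the default [z]. *)
  destruct (choice (fun x y => forall q i, V (T q) -> i < n (T q) ->
      a (T q) (M q) i = x -> y = v (T q) (M q) i)) as [h Hh].
  { intro x.
    destruct (classic (exists q i, V (T q) /\ i < n (T q) /\
                         a (T q) (M q) i = x)) as [[q [i [HV [Hi E]]]]|H].
    - exists (v (T q) (M q) i). intros q' i' HV' Hi' E'.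
      destruct (Hdis q q' i i') as [-> ->]; congruence.
    - exists z. intros q i HV Hi E. exfalso; eauto 6. }
  exists h. intros t Ht N. exists (M (to_nat (t, N))).
  assert (ET : T (to_nat (t, N)) = t) by (unfold T; now rewrite cancel_of_to).
  pose proof (Hp (to_nat (t, N), L (to_nat (t, N)))) as Hq.
  pose proof (fun x => Hh x (to_nat (t, N))) as Hh'.
  cbn [fst snd] in Hq. rewrite ET in Hq, Hh'. rewrite cancel_of_to in Hq.
  destruct (Hq Ht) as [H1 [H2 _]].
  repeat split; auto.
Qed.

(** [P b g h] reads [g] only below [b], so a solution [h] may be chosen for the partial function
    built so far, extended by the arbitrary value [t0]. Locality then replaces this extension by the
    full [F]. *)
Lemma wf_choice (T : Type) (lt : W -> W -> Prop)
    (P : W -> (W -> T) -> T -> Prop) :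
  well_founded lt -> inhabited T ->
  (forall b g, exists h, P b g h) ->
  (forall b g g' h, (forall c, lt c b -> g c = g' c) -> P b g h -> P b g' h) ->
  exists F : W -> T, forall b, P b F (F b).
Proof.
  intros wf HT Hex Hloc. destruct HT as [t0].
  destruct (choice (fun (bg : W * (W -> T)) h => P (fst bg) (snd bg) h))
    as [pick Hp]; [intros [b g]; apply Hex|].
  set (ext := fun b (rec : forall c, lt c b -> T) c =>
    match excluded_middle_informative (lt c b) with
    | left H => rec c H | right _ => t0 end).
  set (F := Fix wf (fun _ => T) (fun b rec => pick (b, ext b rec))).
  exists F. intro b.
  assert (E : F b = pick (b, ext b (fun c _ => F c))).
  { unfold F at 1. rewrite Fix_eq; [reflexivity|].
    intros x g g' Hg. do 2 f_equal. unfold ext. extensionality c.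
    destruct (excluded_middle_informative _); auto. }
  rewrite E. eapply Hloc; [|apply (Hp (b, ext b (fun c _ => F c)))].
  intros c Hc. cbn. unfold ext.
  destruct (excluded_middle_informative _); tauto.
Qed.

End Columns.

(** * Consequences of CH: elements of [W] code sequences and tasks *)

Section Coding.
Variable W : Type.

(** Under CH the points of [W] correspond to reals, and a sequence of reals is coded by a single
    real through pairing. *)
Lemma CH_code_sequences :
  CH_holds W ->
  exists D : W -> nat -> W, forall c, exists x, forall n, D x n = c n.
Proof.
  intros [e [Hinj Hsur]].
  destruct (choice (fun r x => e x = r) Hsur) as [inv Hinv].
  exists (fun x n => inv (fun k => e x (to_nat (n, k)))). intro c.
  destruct (Hsur (fun q => e (c (fst (of_nat q))) (snd (of_nat q)))) as [x Hx].
  exists x. intro n. apply Hinj. rewrite Hinv, Hx. extensionality k.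
  now rewrite cancel_of_to.
Qed.

(** Both arrays are packed into one sequence: index lists of lengths 2 and 4 have different codes,
    so their entries do not collide. *)
Lemma CH_code_tasks :
  CH_holds W ->
  exists (a : W -> nat -> nat -> W) (z : W -> nat -> nat -> nat -> nat -> W),
    forall a' z', exists x, a x = a' /\ z x = z'.
Proof.
  intro CH. destruct (CH_code_sequences CH) as [D HD].
  exists (fun x m i => D x (list_code [m; i])),
         (fun x m i l q => D x (list_code [m; i; l; q])).
  intros a' z'.
  destruct (choice (fun n y =>
      (forall m i, n = list_code [m; i] -> y = a' m i) /\
      (forall m i l q, n = list_code [m; i; l; q] -> y = z' m i l q)))
    as [c Hc].
  { intro n. destruct (classic (exists m i, n = list_code [m; i]))
      as [[m [i ->]]|H].
    - exists (a' m i). split.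
      + intros m' i' E. apply list_code_inj in E. congruence.
      + intros m' i' l' q' E. apply list_code_inj in E. congruence.
    - destruct (classic (exists m i l q, n = list_code [m; i; l; q]))
        as [[m [i [l [q ->]]]]|H'].
      + exists (z' m i l q). split.
        * intros m' i' E. apply list_code_inj in E. congruence.
        * intros m' i' l' q' E. apply list_code_inj in E. congruence.
      + exists (a' 0 0). split; intros; exfalso; eauto 6. }
  destruct (HD c) as [x Hx]. exists x. split.
  - extensionality m. extensionality i. rewrite Hx. now apply (Hc _).
  - extensionality m. extensionality i. extensionality l. extensionality q.
    rewrite Hx. now apply (Hc _).
Qed.

End Coding.

(** * Order properties of the first uncountable ordinal and sorting of finite sets *)

Section Omega1.
Variable W : Type.
Variable lt : W -> W -> Prop.
Hypothesis HW : is_omega1 W lt.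

Lemma lt_irrefl (x : W) : ~ lt x x.
Proof. apply HW. Qed.

Lemma lt_trans (x y z : W) : lt x y -> lt y z -> lt x z.
Proof. apply HW. Qed.

Lemma lt_total (x y : W) : lt x y \/ x = y \/ lt y x.
Proof. apply HW. Qed.

Lemma countable_not_above (a : W) : countable W (fun x => ~ lt a x).
Proof.
  destruct HW as [_ [_ [_ [_ [Hc _]]]]].
  destruct (enum_of_countable W _ a (Hc a)) as [u Hu].
  apply (countable_of_enum W _ (fun n => match n with 0 => a | S n => u n end)).
  intros x Hx. destruct (lt_total x a) as [H|[H|H]]; [|now exists 0|tauto].
  destruct (Hu x H) as [n Hn]. now exists (S n).
Qed.

(** Otherwise every [b] fails to lie above some [x n]. Uncountably many [b] share the same [n], yet
    only countably many points are not above [x n]. *)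
Lemma sequence_bounded (x : nat -> W) : exists b, forall n, lt (x n) b.
Proof.
  apply NNPP. intro H.
  destruct (choice (fun b n => ~ lt (x n) b)) as [c Hc].
  { intro b. apply NNPP. intro Hb. apply H. exists b. intro n.
    apply NNPP. intro Hn. apply Hb. now exists n. }
  destruct (uncountable_fibre W (fun _ => True) c) as [n Hn]; [apply HW|].
  apply Hn. apply countable_subset with (2 := countable_not_above (x n)).
  intros y [_ <-]. apply Hc.
Qed.

Lemma uncountable_unbounded (A : W -> Prop) (s : W -> W) (a : W) :
  uncountable W A ->
  (forall i j, A i -> A j -> s i = s j -> i = j) ->
  exists i, A i /\ lt a (s i).
Proof.
  intros HA Hs. apply NNPP. intro H. apply HA.
  destruct (countable_not_above a) as [g Hg].
  exists (fun i => g (s i)). intros i j Hi Hj E. apply Hs; auto.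
  apply Hg; auto; intro Hlt; apply H; eauto.
Qed.

Lemma sorted_insert (x : W) (l : list W) :
  StronglySorted lt l ->
  exists l', StronglySorted lt l' /\ forall y, In y l' <-> y = x \/ In y l.
Proof.
  induction 1 as [|h l Hl IH Hh].
  - exists [x]. split; [repeat constructor|]. cbn. firstorder.
  - destruct (lt_total x h) as [H|[H|H]].
    + exists (x :: h :: l). split; [|cbn; intuition].
      repeat constructor; auto.
      eapply Forall_impl; [|exact Hh]. intros; eapply lt_trans; eauto.
    + exists (h :: l). split; [now constructor|]. cbn. intuition congruence.
    + destruct IH as [l' [Hs Hin]]. exists (h :: l'). split.
      * constructor; auto. apply Forall_forall. intros y Hy.
        apply Hin in Hy. destruct Hy as [->|Hy]; auto.
        rewrite Forall_forall in Hh. auto.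
      * intro y. cbn. rewrite Hin. intuition.
Qed.

Lemma sorted_exists (l : list W) :
  exists l', StronglySorted lt l' /\ forall y, In y l' <-> In y l.
Proof.
  induction l as [|x l [l1 [H1 H2]]].
  - exists []. split; [constructor|tauto].
  - destruct (sorted_insert x l1 H1) as [l' [H3 H4]]. exists l'. split; auto.
    intro y. rewrite H4, H2. cbn. intuition.
Qed.

Lemma sorted_nth_lt (l : list W) (z : W) (i j : nat) :
  StronglySorted lt l -> i < j < length l -> lt (nth i l z) (nth j l z).
Proof.
  intro H. revert i j. induction H as [|h l Hl IH Hh]; intros i j Hij;
    cbn in Hij; [lia|].
  destruct j as [|j]; [lia|]. destruct i as [|i]; cbn.
  - rewrite Forall_forall in Hh. apply Hh, nth_In. lia.
  - apply IH. lia.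
Qed.

(** * The generic colouring *)

Section Colouring.
Variable pbar : W -> W -> W -> nat.
Variable ca : W -> nat -> nat -> W.
Variable cz : W -> nat -> nat -> nat -> nat -> W.

(* Columns come first: [F b a] is the colour of the pair [{a, b}], [a < b]. *)
Definition meets_columns (F : W -> W -> W) (n : nat) (d x : W)
    (cs : list W) (m : nat) : Prop :=
  forall l i, l < length cs -> i < n ->
    F (nth l cs d) (ca x m i) =
    cz x m i l (pbar d (ca x m i) (nth l cs d)).

(** [F] is consulted only at the columns in [cs], all below [b]; this locality permits the recursion
    on [b]. The new column takes position [length cs] in the target matrix. *)
Definition generic_over (b : W) (F : W -> W -> W) (h : W -> W) : Prop :=
  forall n d x cs,
    lt d b -> lt x b -> Forall (fun c => lt c b) cs ->
    disjoint_sets W n (ca x) ->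
    infinitely_many (meets_columns F n d x cs) ->
    infinitely_many (fun m => meets_columns F n d x cs m /\
      forall i, i < n ->
        h (ca x m i) = cz x m i (length cs) (pbar d (ca x m i) b)).

Lemma generic_over_exists (b : W) (F : W -> W -> W) :
  exists h, generic_over b F h.
Proof.
  destruct HW as [_ [_ [_ [_ [Hc _]]]]].
  destruct (enum_tasks W _ (Hc b)) as [u Hu].
  set (n := fun t => fst (u t)).
  (* A request is enumerated as the size [n] with the list [d :: x :: cs]. *)
  set (d := fun t => nth 0 (snd (u t)) b).
  set (x := fun t => nth 1 (snd (u t)) b).
  set (cs := fun t => skipn 2 (snd (u t))).
  destruct (generic_column W
    (fun t => disjoint_sets W (n t) (ca (x t)) /\
              infinitely_many (meets_columns F (n t) (d t) (x t) (cs t)))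
    n (fun t => meets_columns F (n t) (d t) (x t) (cs t))
    (fun t => ca (x t))
    (fun t m i => cz (x t) m i (length (cs t)) (pbar (d t) (ca (x t) m i) b)) b)
    as [h Hh]; [tauto|tauto|].
  exists h. intros n' d' x' cs' Hd Hx Hcs Ha HX.
  destruct (Hu n' (d' :: x' :: cs')) as [t Ht]; [repeat constructor; auto|].
  specialize (Hh t). unfold n, d, x, cs in Hh. rewrite Ht in Hh. cbn in Hh.
  auto.
Qed.

Lemma generic_colouring_exists :
  exists F : W -> W -> W, forall b, generic_over b F (F b).
Proof.
  apply (wf_choice W (W -> W) lt generic_over).
  - apply HW.
  - exact (inhabits (fun x => x)).
  - apply generic_over_exists.
  - intros b g g' h Hg HP n d x cs Hd Hx Hcs Ha HX.
    assert (E : forall m, meets_columns g n d x cs m <->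
                          meets_columns g' n d x cs m).
    { intro m. unfold meets_columns. rewrite Forall_forall in Hcs.
      split; intros H l i Hl Hi; specialize (H l i Hl Hi);
        [rewrite <- Hg|rewrite Hg]; auto; apply Hcs, nth_In; auto. }
    assert (HX' : infinitely_many (meets_columns g n d x cs)).
    { intro N. destruct (HX N) as [m [Hm H]]. exists m. now rewrite E. }
    intro N. destruct (HP n d x cs Hd Hx Hcs Ha HX' N) as [m [Hm [H1 H2]]].
    exists m. rewrite <- E. auto.
Qed.

(** * Meeting targets with the generic colouring *)

Hypothesis code : forall a z, exists x, ca x = a /\ cz x = z.
Variable F : W -> W -> W.
Hypothesis HF : forall b, generic_over b F (F b).

Lemma task_bound (d x : W) :
  exists b, lt d b /\ lt x b /\ forall m i, lt (ca x m i) b.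
Proof.
  destruct (sequence_bounded (fun q => match q with
    | 0 => d | 1 => x
    | S (S q) => ca x (fst (of_nat q)) (snd (of_nat q)) end)) as [b Hb].
  exists b. repeat split; [apply (Hb 0)|apply (Hb 1)|].
  intros m i. specialize (Hb (S (S (to_nat (m, i))))). cbv beta iota in Hb.
  now rewrite cancel_of_to in Hb.
Qed.

(** If every [u m] failed, with counterexample [Z m], the singletons [u m] with targets [Z m] would
    form a task. Any column of [B] high enough meets some [Z m] at [u m], a contradiction. *)
Lemma colouring_one_point (d : W) (u : nat -> W) (B : W -> Prop) :
  (forall m n, u m = u n -> m = n) -> uncountable W B ->
  exists m, strong W lt (fun a b => F b a) (pbar d)
              (circ W (fun x => x = u m) B).
Proof.
  intros Hu HB. apply NNPP. intro H.
  destruct (choice (fun m (zeta : nat -> W) => forall b, lt (u m) b -> B b ->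
               F b (u m) <> zeta (pbar d (u m) b))) as [Z HZ].
  { intro m. apply NNPP. intro Hm. apply H. exists m. intro zeta.
    apply NNPP. intro Hz. apply Hm. exists zeta. intros b Hb HBb E.
    apply Hz. exists (u m), b. repeat split; auto. }
  destruct (code (fun m _ => u m) (fun m _ _ => Z m)) as [x [Ea Ez]].
  destruct (task_bound d x) as [c [Hd [Hx Hc]]].
  destruct (uncountable_unbounded B (fun b => b) c HB) as [b [HBb Hb]]; auto.
  (* With no earlier columns, every [m] meets the task vacuously. *)
  destruct (HF b 1 d x []) with (N := 0) as [m [_ [_ Hm]]];
    eauto using lt_trans.
  - rewrite Ea. intros m m' i i' Hi Hi' E. apply Hu in E. lia.
  - intro N. exists N. split; auto. intros l i Hl. cbn in Hl. lia.
  - specialize (Hm 0 Nat.lt_0_1). rewrite Ea, Ez in Hm.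
    apply (HZ m b); auto. specialize (Hc m 0). rewrite Ea in Hc.
    eauto using lt_trans.
Qed.

Lemma colouring_matrix (d : W) (A : W -> Prop) (n : nat) (s : W -> nat -> W)
    (zeta : nat -> nat -> nat -> W) :
  uncountable W A -> 0 < n ->
  (forall i k l, A i -> k < l < n -> lt (s i k) (s i l)) ->
  (forall i j k l, A i -> A j -> k < n -> l < n -> s i k = s j l -> i = j) ->
  exists i j, A i /\ A j /\ i <> j /\
    (forall k l, k < n -> l < n -> lt (s i k) (s j l)) /\
    (forall k l, k < n -> l < n ->
       F (s j l) (s i k) = zeta k l (pbar d (s i k) (s j l))).
Proof.
  intros HA Hn Hinc Hdis.
  destruct (infinite_sequence W A) as [u [HuA Hu]];
    [now apply uncountable_not_finite|].
  (* The task consists of countably many members of the family, all with the same target matrix. *)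
  destruct (code (fun m i => s (u m) i) (fun _ i l => zeta i l))
    as [x [Ea Ez]].
  destruct (task_bound d x) as [c [Hd [Hx Hc]]].
  (* Sets are listed increasingly, so it suffices that the minimum [s j 0] exceeds the bound [c]. *)
  destruct (uncountable_unbounded A (fun j => s j 0) c HA) as [j [HAj Hj]].
  { intros i j Hi Hj. apply Hdis; auto. }
  assert (Hjl : forall l, l < n -> lt c (s j l)).
  { intros [|l] Hl; auto. eapply lt_trans; [exact Hj|]. apply Hinc; auto. lia. }
  assert (Hdisj : disjoint_sets W n (ca x)).
  { rewrite Ea. intros m m' i i' Hi Hi' E.
    assert (Em : m = m') by (apply Hu, (Hdis _ _ i i'); auto).
    subst m'. split; auto.
    destruct (Nat.lt_trichotomy i i') as [H|[H|H]]; auto; exfalso.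
    - apply (lt_irrefl (s (u m) i)). rewrite E at 2. apply Hinc; auto.
    - apply (lt_irrefl (s (u m) i)). rewrite E at 1. apply Hinc; auto. }
  (* Genericity of column [s j k] over the columns [s j 0], ..., [s j (k-1)] gives the induction
     step. *)
  assert (Hk : forall k, k <= n ->
    infinitely_many (meets_columns F n d x (map (s j) (seq 0 k)))).
  { induction k as [|k IH]; intro Hkn.
    - intro N. exists N. split; auto. intros l i Hl. cbn in Hl. lia.
    - intro N. destruct (HF (s j k) n d x (map (s j) (seq 0 k))) with (N := N)
        as [m [HN [Hm1 Hm2]]]; eauto using lt_trans with arith.
      + apply Forall_forall. intros y Hy. apply in_map_iff in Hy.
        destruct Hy as [l [<- Hl]]. apply in_seq in Hl. apply Hinc; auto; lia.
      + exists m. split; auto. intros l i Hl Hi.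
        rewrite seq_S, map_app in *. cbn [map Nat.add] in *.
        rewrite length_app, length_map, length_seq in Hl. cbn in Hl.
        rewrite length_map, length_seq in Hm2.
        destruct (Nat.eq_dec l k) as [->|Hne].
        * rewrite app_nth2; rewrite length_map, length_seq; [|lia].
          rewrite Nat.sub_diag. cbn [nth]. auto.
        * rewrite app_nth1; [|rewrite length_map, length_seq; lia].
          apply Hm1; auto. rewrite length_map, length_seq. lia. }
  destruct (Hk n (le_n n) 0) as [m [_ Hm]].
  assert (Hlt : forall k l, k < n -> l < n -> lt (s (u m) k) (s j l)).
  { intros k l Hk' Hl. specialize (Hc m k). rewrite Ea in Hc.
    eauto using lt_trans. }
  exists (u m), j. repeat split; auto.
  (* Were [u m] equal to [j], [Hlt] would put [s j 0] below itself. *)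
  - intros E. apply (lt_irrefl (s j 0)). rewrite <- E at 1. auto.
  - intros k l Hk' Hl. specialize (Hm l k).
    rewrite length_map, length_seq in Hm. specialize (Hm Hl Hk').
    rewrite Ea, Ez in Hm.
    rewrite (nth_indep _ d (s j 0)) in Hm
      by (rewrite length_map, length_seq; auto).
    rewrite map_nth, seq_nth in Hm by auto. exact Hm.
Qed.

(** * Deriving the individual relations *)

Lemma colouring_Pr0 : Pr0 W lt pbar.
Proof.
  exists (fun a b => F b a). intros d [|n] s Hinc Hdis zeta.
  (* For size 0 all conditions are vacuous except that the two indices differ. *)
  - destruct (infinite_sequence W (fun _ => True)) as [u [_ Hu]].
    { apply uncountable_not_finite, HW. }
    exists (u 0), (u 1). repeat split; try lia.
    intro E. apply Hu in E. discriminate.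
  - destruct (colouring_matrix d (fun _ => True) (S n) s zeta)
      as [i [j [_ [_ H]]]]; [apply HW|lia|auto|eauto|].
    now exists i, j.
Qed.

(** Sorting turns each member into a strictly increasing list, removing repetitions in [s i].
    Uncountably many of these lists share one length [n], and the constant target matrix applies to
    them. *)
Lemma colouring_Pr1 : Pr1 W lt pbar.
Proof.
  exists (fun a b => F b a). intros d xi len s Hlen Hdis zeta.
  destruct (choice (fun i l => StronglySorted lt l /\
              forall y, In y l <-> In y (map (s i) (seq 0 (len i)))))
    as [L HL]; [intro i; apply sorted_exists|].
  destruct (uncountable_fibre W (fun _ => True) (fun i => length (L i)))
    as [n Hn]; [apply HW|].
  assert (HLs : forall i y, In y (L i) <-> exists k, k < len i /\ s i k = y).
  { intros i y. rewrite (proj2 (HL i)), in_map_iff.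
    split; intros [k Hk]; exists k; rewrite in_seq in *; intuition lia. }
  destruct (colouring_matrix d (fun i => True /\ length (L i) = n) n
    (fun i k => nth k (L i) d) (fun _ _ => zeta))
    as [i [j [[_ Hi] [[_ Hj] [Hij [H1 H2]]]]]]; auto.
  - destruct (uncountable_inhabited W _ Hn) as [i [_ <-]].
    assert (Hin : In (s i 0) (L i)).
    { apply HLs. exists 0. split; auto. apply Hlen. }
    destruct (L i); [easy|cbn; lia].
  - intros i k l [_ <-] Hkl. apply sorted_nth_lt; auto. apply HL.
  - intros i j k l [_ Hi] [_ Hj] Hk Hl E.
    assert (HI : In (nth k (L i) d) (L i)) by (apply nth_In; lia).
    assert (HJ : In (nth l (L j) d) (L j)) by (apply nth_In; lia).
    apply HLs in HI. apply HLs in HJ.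
    destruct HI as [k' [Hk' Ek]]. destruct HJ as [l' [Hl' El]].
    apply (Hdis i j k' l'); congruence.
  (* Every original [s i k] is an entry of the sorted list, so the conclusions transfer back. *)
  - assert (Hnth : forall i k, length (L i) = n -> k < len i ->
              exists k', k' < n /\ nth k' (L i) d = s i k).
    { intros i' k <- Hk. apply In_nth, HLs. eauto. }
    exists i, j. split; auto. split; intros k l Hk Hl;
      destruct (Hnth i k Hi Hk) as [k' [Hk' <-]];
      destruct (Hnth j l Hj Hl) as [l' [Hl' <-]]; auto.
Qed.

Lemma colouring_neg_circ01 : neg_circ01 W lt pbar.
Proof.
  exists (fun a b => F b a). intros d A B [_ HA] HB.
  destruct (infinite_sequence W A HA) as [u [HuA Hu]].
  destruct (colouring_one_point d u B Hu HB) as [m Hm]. eauto.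
Qed.

Lemma colouring_circ (d : W) (A B : W -> Prop) :
  uncountable W A -> uncountable W B ->
  strong W lt (fun a b => F b a) (pbar d) (circ W A B).
Proof.
  intros HA HB zeta.
  destruct (infinite_sequence W A) as [u [HuA Hu]];
    [now apply uncountable_not_finite|].
  destruct (colouring_one_point d u B Hu HB) as [m Hm].
  destruct (Hm zeta) as [a [b [Hab [[-> HBb] E]]]].
  exists (u m), b. repeat split; auto.
Qed.

End Colouring.
End Omega1.

Theorem theorem5p1 (W : Type) (lt : W -> W -> Prop) :
  is_omega1 W lt -> CH_holds W ->
  forall pbar : W -> W -> W -> nat,
    neg_sq W lt pbar /\ neg_circ W lt pbar /\ neg_circ01 W lt pbar /\
    Pr1 W lt pbar /\ Pr0 W lt pbar.
Proof.
  intros HW CH pbar.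
  destruct (CH_code_tasks W CH) as [ca [cz code]].
  destruct (generic_colouring_exists W lt HW pbar ca cz) as [F HF].
  repeat split.
  - exists (fun a b => F b a). intros d A HA.
    (* [sq W A] and [circ W A A] unfold to the same relation. *)
    exact (colouring_circ W lt HW pbar ca cz code F HF d A A HA HA).
  - exists (fun a b => F b a).
    exact (colouring_circ W lt HW pbar ca cz code F HF).
  - exact (colouring_neg_circ01 W lt HW pbar ca cz code F HF).
  - exact (colouring_Pr1 W lt HW pbar ca cz code F HF).
  - exact (colouring_Pr0 W lt HW pbar ca cz code F HF).
Qed.
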